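(* Let $m_1,m_2\geq 1$ and $m_3\geq 2$ be integers. Then \begin{align*} S_{1m_1m_2,m_3}=&(-1)^{m_3-1}\sum_{i=1}^{m_3-2}(-1)^{i-1}\zeta(m_3-i)S_{m_1m_2,i+1}\\ &+(-1)^{m_3}\big(S_{m_1,m_2+1}+S_{m_2,m_1+1}-\zeta(m_1+m_2+1)\big)\zeta(m_3)\\ &+(-1)^{m_3}\Big\{\sum_{i=1}^{m_2-1}(-1)^{i-1}S_{m_1,m_2+1-i}\,\zeta(m_3,i)+\sum_{i=1}^{m_1-1}(-1)^{i-1}S_{m_2,m_1+1-i}\,\zeta(m_3,i)\Big\}\\ &+(-1)^{m_3}\Big\{(-1)^{m_2-1}\zeta(m_1+1)\zeta(m_3,m_2)+(-1)^{m_1-1}\zeta(m_2+1)\zeta(m_3,m_1)\Big\}\\ &+(-1)^{m_3}\Big\{(-1)^{m_2-1}\sum_{i=1}^{m_1-1}(-1)^{i-1}\zeta(m_1+1-i)\zeta(m_3,m_2,i)\\ &\qquad\qquad+(-1)^{m_1-1}\sum_{i=1}^{m_2-1}(-1)^{i-1}\zeta(m_2+1-i)\zeta(m_3,m_1,i)\Big\}\\ &+(-1)^{m_1+m_2+m_3}\Big\{\zeta(m_3,m_2,m_1,1)+\zeta(m_3,m_1,m_2,1)+\zeta(m_3,m_2,m_1+1)\\ &\qquad\qquad+\zeta(m_3,m_1,m_2+1)+\zeta(m_3,m_1+m_2,1)+\zeta(m_3,m_1+m_2+1)\Big\}\\ &-(-1)^{m_3}\sum_{i=1}^{m_1+m_2-1}(-1)^{i-1}\zeta(m_1+m_2+1-i)\zeta(m_3,i).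 \end{align*}
   Context: For positive integers $k$ and $n\ge0$, $H_n^{(k)}=\sum_{j=1}^n j^{-k}$ and $H_n=H_n^{(1)}$. For positive integers $s_1,\dots,s_r$ and $q\ge 2$, $S_{s_1\cdots s_r,q}=\sum_{n=1}^\infty H_n^{(s_1)}\cdots H_n^{(s_r)}/n^q$; e.g. $S_{1m_1m_2,m_3}=\sum_{n\ge1}H_nH_n^{(m_1)}H_n^{(m_2)}/n^{m_3}$, $S_{m_1m_2,q}=\sum_{n\ge1}H_n^{(m_1)}H_n^{(m_2)}/n^q$, $S_{p,q}=\sum_{n\ge1}H_n^{(p)}/n^q$. For positive integers $s_1\ge2,s_2,\dots,s_k$, the multiple zeta value is $\zeta(s_1,\dots,s_k)=\sum_{n_1>n_2>\cdots>n_k\ge1}n_1^{-s_1}\cdots n_k^{-s_k}$; for $k=1$ this is the Riemann zeta function. Empty sums are $0$. *)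

(* Defs.v *)
From mathcomp Require Import all_boot all_order all_algebra.
From mathcomp Require Import all_classical all_reals all_analysis.

Set Implicit Arguments.
Unset Strict Implicit.
Unset Printing Implicit Defensive.

Import Order.TTheory GRing.Theory Num.Theory.
Import numFieldNormedType.Exports.

Local Open Scope classical_set_scope.
Local Open Scope ring_scope.

Section EulerSums.
Variable R : realType.

(* H_n^(k) *)
Definition gharm (k n : nat) : R := \sum_(1 <= j < n.+1) j%:R ^- k.

(* S_{s_1...s_r, q}; meaningful for q >= 2, where the series converges. *)
Definition euler_sum (s : seq nat) (q : nat) : R :=
  \big[+%R/0]_(1 <= n <oo) ((\prod_(k <- s) gharm k n) / n%:R ^+ q).

(* mzv_trunc [:: s_1; ...; s_k] N is the finite sum, over all integers
   N > n_1 > n_2 > ... > n_k >= 1, of n_1^-s_1 * ... * n_k^-s_k. *)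
Fixpoint mzv_trunc (s : seq nat) (N : nat) : R :=
  if s is k :: s' then \sum_(1 <= n < N) n%:R ^- k * mzv_trunc s' n else 1.

(* zeta(s_1, ..., s_k); meaningful for s_1 >= 2, where the limit exists. *)
Definition mzv (s : seq nat) : R := limn (mzv_trunc s).

End EulerSums.

Arguments gharm {R} k n.
Arguments euler_sum {R} s q.
Arguments mzv_trunc {R} s N.
Arguments mzv {R} s.

(* Main.v *)
(* Put f(n) = H_n^(m1) H_n^(m2) and sum f(n) / (n k^(m3-1) (n + k)) over all
   n, k >= 1 in both orders. Over k first, partial fractions in k and
   sum_k (1/k - 1/(n + k)) = H_n give zeta values times the S_{m1 m2, i+1}, plus
   (-1)^m3 S_{1 m1 m2, m3}. Over n first, the inner sum is
   sum_n f(n) (1/n - 1/(n + k)), which summation by parts turns into the sum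
   over 0 <= j < k of sum_n (f(n) - f(n-1)) / (n + j). Since f(n) - f(n-1) is
   H_n^(m1) / n^m2 + H_n^(m2) / n^m1 - 1 / n^(m1+m2), partial fractions in n and
   the same step for a single harmonic number, then for the constant 1, leave
   only nested sums over k > j > ..., that is, multiple zeta values. *)
Require Import Defs.
From mathcomp Require Import all_boot all_order all_algebra.
From mathcomp Require Import all_classical all_reals all_analysis.
From mathcomp Require Import ring.

Set Implicit Arguments.
Unset Strict Implicit.
Unset Printing Implicit Defensive.

Import Order.TTheory GRing.Theory Num.Theory.
Import numFieldNormedType.Exports.

Local Open Scope classical_set_scope.
Local Open Scope ring_scope.

Lemma subrX_le (K : numDomainType) (x y : K) r : 0 <= y <= x ->
  x ^+ r.+1 - y ^+ r.+1 <= r.+1%:R * (x - y) * x ^+ r.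
Proof.
move=> /andP[y0 yx]; rewrite subrXX -mulrA mulrCA ler_wpM2l ?subr_ge0//.
rewrite -[in leRHS](card_ord r.+1) mulr_natl -sumr_const; apply: ler_sum => i _.
rewrite -[in leRHS](@subnK i r) ?exprD; last by rewrite -ltnS.
by rewrite ler_wpM2l ?exprn_ge0 ?(le_trans y0)// lerXn2r// nnegrE (le_trans y0).
Qed.

Lemma alternating_recurrence_sum (K : comPzRingType) (x z : nat -> K) t m :
  (forall i, (0 < i)%N -> x i.+1 = t * (z i.+1 - x i)) -> (0 < m)%N ->
  x m = \sum_(1 <= i < m) (-1) ^+ (i - 1) * z (m + 1 - i)%N * t ^+ i
    + (-1) ^+ (m - 1) * t ^+ (m - 1) * x 1.
Proof.
move=> xS; case: m => // m _; elim: m => [|m IH].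
  by rewrite big_geq// add0r !expr0 !mul1r.
rewrite xS// IH [in RHS]big_nat_recl// !subn1 !addn1 /= expr0 expr1 mul1r.
have -> : \sum_(1 <= i < m.+1)
      (-1) ^+ (i.+1 - 1) * z (m.+3 - i.+1)%N * t ^+ i.+1
    = - t * \sum_(1 <= i < m.+1) (-1) ^+ (i - 1) * z (m.+2 - i)%N * t ^+ i.
  rewrite mulr_sumr; apply: eq_big_nat => -[//|i] _.
  by rewrite !subn1 subSS !exprS; ring.
by rewrite !exprS; ring.
Qed.

Section NestedSums.
Variable R : realType.
Implicit Types (s : seq nat) (u v : nat -> R) (l : R).

(* nested_sum [:: s_1; ...; s_k] u N is the sum, over all integers
   N > n_1 > ... > n_k > n >= 1, of n_1^-s_1 * ... * n_k^-s_k * u n. *)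
Fixpoint nested_sum s u (N : nat) : R :=
  if s is k :: s' then \sum_(1 <= n < N) n%:R ^- k * nested_sum s' u n
  else \sum_(1 <= n < N) u n.

Lemma eq_nested_sum s u v : (forall n, (0 < n)%N -> u n = v n) ->
  nested_sum s u = nested_sum s v.
Proof.
move=> uv; elim: s => [|k s /= ->//]; apply/funext => N /=.
by apply: eq_big_nat => n /andP[/uv].
Qed.

Lemma nested_sumD s u v N :
  nested_sum s (fun n => u n + v n) N = nested_sum s u N + nested_sum s v N.
Proof.
elim: s N => [|k s IH] N /=; first by rewrite big_split.
by rewrite -big_split; apply: eq_bigr => n _; rewrite IH mulrDr.
Qed.

Lemma nested_sumZ s c u N :
  nested_sum s (fun n => c * u n) N = c * nested_sum s u N.
Proof.
elim: s N => [|k s IH] N /=; first by rewrite mulr_sumr.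
by rewrite mulr_sumr; apply: eq_bigr => n _; rewrite IH mulrCA.
Qed.

Lemma nested_sum_rcons s p u : nested_sum (rcons s p) u =
  nested_sum s (fun n => n%:R ^- p * \sum_(1 <= j < n) u j).
Proof. by elim: s => [|k s /= ->]. Qed.

Lemma nested_sum_invX s p :
  nested_sum s (fun n => n%:R ^- p) = mzv_trunc (rcons s p).
Proof.
elim: s => [|k s /= ->//]; apply/funext => N /=.
by apply: eq_bigr => n _; rewrite mulr1.
Qed.

Lemma eq_cvg_nested_sum s u v l : (forall n, (0 < n)%N -> u n = v n) ->
  nested_sum s u @ \oo --> l -> nested_sum s v @ \oo --> l.
Proof. by move=> uv; rewrite (eq_nested_sum s uv). Qed.

Lemma cvg_nested_sumD s u v a b :
  nested_sum s u @ \oo --> a -> nested_sum s v @ \oo --> b ->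
  nested_sum s (fun n => u n + v n) @ \oo --> a + b.
Proof. by move=> ua vb; rewrite (funext (nested_sumD s u v)); exact: cvgD. Qed.

Lemma cvg_nested_sumZ s c u l :
  nested_sum s u @ \oo --> l -> nested_sum s (fun n => c * u n) @ \oo --> c * l.
Proof. by rewrite (funext (nested_sumZ s c u)); exact: cvgMl_tmp. Qed.

Lemma cvg_nested_sumB s u v a b :
  nested_sum s u @ \oo --> a -> nested_sum s v @ \oo --> b ->
  nested_sum s (fun n => u n - v n) @ \oo --> a - b.
Proof.
move=> ua /(cvg_nested_sumZ (c := -1)) /(cvg_nested_sumD ua).
by rewrite mulN1r; apply: eq_cvg_nested_sum => n _; rewrite mulN1r.
Qed.

Lemma cvg_nested_sum_sum s (I : eqType) (r : seq I) (w : I -> nat -> R)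
    (l : I -> R) :
  (forall i, i \in r -> nested_sum s (w i) @ \oo --> l i) ->
  nested_sum s (fun n => \sum_(i <- r) w i n) @ \oo --> \sum_(i <- r) l i.
Proof.
elim: r => [|i r IH] wl.
  rewrite big_nil.
  have sum0 N : nested_sum s (fun n => \sum_(i <- [::]) w i n) N = 0.
    under eq_nested_sum do rewrite big_nil -(mul0r 0).
    by rewrite nested_sumZ mul0r.
  by rewrite (funext sum0); exact: cvg_cst.
rewrite big_cons.
apply: eq_cvg_nested_sum (cvg_nested_sumD (wl i _) (IH _)) => [n _||j jr].
- by rewrite big_cons.
- exact: mem_head.
- by apply: wl; rewrite in_cons jr orbT.
Qed.

End NestedSums.

Local Notation psum := (nested_sum [::]).

Section Series.
Variable R : realType.
Implicit Types (u v : nat -> R) (l : R).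

Lemma lim_psum u l :
  psum u @ \oo --> l -> \big[+%R/0]_(1 <= n <oo) u n = l.
Proof. exact: cvg_lim. Qed.

Lemma cvg_psum_nneseries u l : (forall n, (0 < n)%N -> 0 <= u n) ->
  psum u @ \oo --> l <-> (\sum_(1 <= n <oo) (u n)%:E = l%:E)%E.
Proof.
move=> u0.
have EFin_psum : EFin \o psum u = (fun N => \sum_(1 <= n < N) (u n)%:E)%E.
  by apply/funext => N /=; rewrite sumEFin.
split=> [ul|ul].
  rewrite -EFin_psum; apply/cvg_lim => //.
  by apply: cvg_EFin ul; exact: nearW.
suff : (fine \o (EFin \o psum u)) @ \oo --> l by [].
apply: fine_cvg; rewrite EFin_psum -ul.
by apply: is_cvg_nneseries => n n0 _; rewrite lee_fin u0.
Qed.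

Lemma cvg_psum_ge0 u l : (forall n, (0 < n)%N -> 0 <= u n) ->
  psum u @ \oo --> l -> 0 <= l.
Proof.
move=> u0 ul; apply: (cvgr_to_ge ul); apply: nearW => N /=.
by rewrite big_nat sumr_ge0// => n /andP[/u0].
Qed.

Lemma cvg_psum_exchange (a : nat -> nat -> R) (r c : nat -> R) l :
  (forall n k, 0 <= a n k) ->
  (forall n, (0 < n)%N -> psum (a n) @ \oo --> r n) ->
  (forall k, (0 < k)%N -> psum (a ^~ k) @ \oo --> c k) ->
  psum r @ \oo --> l -> psum c @ \oo --> l.
Proof.
move=> a0 ar ac.
have r0 n : (0 < n)%N -> 0 <= r n by move=> /ar; exact: cvg_psum_ge0.
have c0 k : (0 < k)%N -> 0 <= c k by move=> /ac; exact: cvg_psum_ge0.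
move=> /(cvg_psum_nneseries _ r0) rl; apply/(cvg_psum_nneseries _ c0).
rewrite -rl !ereal_series.
transitivity (\sum_(k <oo | (1 <= k)%N) \sum_(n <oo | (1 <= n)%N) (a n k)%:E)%E.
  apply: eq_eseriesr => k k0; apply/esym; rewrite -ereal_series.
  by apply/cvg_psum_nneseries; [move=> n _; exact: a0|exact: ac].
rewrite nneseries_interchange; last by move=> *; rewrite lee_fin.
apply: eq_eseriesr => n n0; rewrite -ereal_series.
by apply/cvg_psum_nneseries; [move=> k _; exact: a0|exact: ar].
Qed.

Lemma is_cvg_psum_le u v : (forall n, (0 < n)%N -> 0 <= u n <= v n) ->
  cvgn (psum v) -> cvgn (psum u).
Proof.
move=> uv /cvg_seq_bounded/bounded_fun_has_ubound[M vM].
apply: nondecreasing_is_cvgn.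
  by apply: nondecreasing_series => n /uv/andP[].
exists M => _ [N _ <-]; apply: (le_trans _ (vM (psum v N) _)); last by exists N.
by apply: ler_sum_nat => n /andP[/uv/andP[]].
Qed.

Lemma cvg_psum_telescope (b : nat -> R) i : (0 < i)%N -> b @ \oo --> 0 ->
  psum (fun n => (i <= n)%:R * (b n - b n.+1)) @ \oo --> b i.
Proof.
move=> i0 b0; suff sumE : \forall N \near \oo,
    b i - b N = psum (fun n => (i <= n)%:R * (b n - b n.+1)) N.
  have : (fun N => b i - b N) @ \oo --> b i - 0.
    by apply: cvgB => //; exact: cvg_cst.
  by rewrite subr0; apply: cvg_trans; exact: near_eq_cvg.
exists i => // N /= iN.
rewrite (big_cat_nat i0 iN)//= big_nat big1 => [|n /andP[_ ni]]; last first.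
  by rewrite leqNgt ni mul0r.
rewrite add0r -opprB -telescope_sumr// -sumrN.
apply: eq_big_nat => n /andP[-> _].
by rewrite mul1r opprB.
Qed.

(* Both series rearrange the double series of (f i - f i.-1) (b n - b n.+1)
   over 1 <= i <= n. *)
Lemma cvg_psum_by_parts (f b : nat -> R) l :
  f 0 = 0 -> nondecreasing_seq f ->
  (forall n, (0 < n)%N -> b n.+1 <= b n) -> b @ \oo --> 0 ->
  psum (fun n => (f n - f n.-1) * b n) @ \oo --> l ->
  psum (fun n => f n * (b n - b n.+1)) @ \oo --> l.
Proof.
move=> f0 f_nd b_le b0; apply: (@cvg_psum_exchange
  (fun i n => (f i - f i.-1) * ((i <= n)%:R * (b n - b n.+1)))).
- move=> i [|n]; first by case: i => [|i]; rewrite ?f0 ?subrr ?mul0r ?mulr0.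
  by rewrite !mulr_ge0// subr_ge0; [exact/f_nd/leq_pred|exact: b_le].
- by move=> i i0; apply: cvg_nested_sumZ; exact: cvg_psum_telescope.
move=> n n0.
have -> : f n * (b n - b n.+1)
    = \sum_(1 <= i < n.+1) (f i - f i.-1) * (b n - b n.+1).
  by rewrite -mulr_suml big_add1/= telescope_sumr// f0 subr0.
apply: cvg_near_cst; exists n.+1 => // N /= nN.
rewrite (big_cat_nat (ltn0Sn n) nN)/=.
rewrite [X in _ + X]big_nat [X in _ + X]big1 ?addr0.
  by apply: eq_big_nat => i /andP[_]; rewrite ltnS => ->; rewrite mul1r.
by move=> i /andP[ni _]; rewrite leqNgt ni mul0r mulr0.
Qed.

Lemma cvg_invr_natD k : (fun n => (n + k)%:R^-1 : R) @ \oo --> 0.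
Proof.
rewrite (cvg_shiftn k (fun n => n%:R^-1 : R)) -cvg_shiftS.
exact: cvg_harmonic.
Qed.

Lemma cvg_psum_by_parts_natD (f v : nat -> R) k :
  f 0 = 0 -> nondecreasing_seq f ->
  (forall j, (j < k)%N ->
    psum (fun n => (f n - f n.-1) / (n + j)%:R) @ \oo --> v j) ->
  psum (fun n => f n * (n%:R^-1 - (n + k)%:R^-1)) @ \oo -->
    \sum_(0 <= j < k) v j.
Proof.
move=> f0 f_nd dv.
have /cvg_nested_sum_sum : forall j, j \in index_iota 0 k ->
    psum (fun n => f n * ((n + j)%:R^-1 - (n.+1 + j)%:R^-1)) @ \oo --> v j.
  move=> j; rewrite mem_index_iota => /andP[_ /dv].
  apply: cvg_psum_by_parts => // [n n0|]; last exact: cvg_invr_natD.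
  by rewrite lef_pV2 ?posrE ?ltr0n ?addn_gt0 ?n0// ler_nat.
apply: eq_cvg_nested_sum => n _.
rewrite -mulr_sumr (telescope_sumr_eq (fun j => - (n + j)%:R^-1))//.
  by rewrite addn0 opprK addrC.
by move=> j _; rewrite opprK addrC addnS.
Qed.

End Series.

Section HarmonicNumbers.
Variable R : realType.

Lemma gharm0 k : gharm k 0 = 0 :> R.
Proof. by rewrite /gharm big_geq. Qed.

Lemma gharmS k n : gharm k n.+1 = gharm k n + n.+1%:R ^- k :> R.
Proof. by rewrite /gharm big_nat_recr. Qed.

Lemma gharm_ge0 k n : 0 <= gharm k n :> R.
Proof. by apply: sumr_ge0 => j _; rewrite invr_ge0 exprn_ge0. Qed.

Lemma gharm_nondecreasing k : nondecreasing_seq (gharm k : nat -> R).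
Proof.
by apply/nondecreasing_seqP => n; rewrite gharmS lerDl invr_ge0 exprn_ge0.
Qed.

Lemma gharmX_nondecreasing k r :
  nondecreasing_seq (fun n => gharm k n ^+ r : R).
Proof.
move=> m n mn; rewrite lerXn2r ?nnegrE ?gharm_ge0//.
exact: gharm_nondecreasing.
Qed.

Lemma gharmX_subS_le k r n :
  gharm k n.+1 ^+ r.+1 - gharm k n ^+ r.+1
  <= r.+1%:R * n.+1%:R ^- k * gharm k n.+1 ^+ r :> R.
Proof.
have := @subrX_le R (gharm k n.+1) (gharm k n) r.
rewrite gharm_ge0 gharm_nondecreasing ?leqnSn// => /(_ isT).
by rewrite [X in _ * (X - _) * _]gharmS [X in _ * X * _]addrAC subrr add0r.
Qed.

Lemma gharm_le_gharm1 k n : (0 < k)%N -> gharm k n <= gharm 1 n :> R.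
Proof.
move=> k0; apply: ler_sum_nat => j /andP[j0 _].
by rewrite lef_pV2 ?posrE ?exprn_gt0 ?ltr0n// ler_weXn2l// ler1n.
Qed.

Lemma is_cvg_psum_div_sqr (f : nat -> R) : (forall n, 0 <= f n) ->
  cvgn (psum (fun n => f n * (n%:R^-1 - n.+1%:R^-1))) ->
  cvgn (psum (fun n => f n / n%:R ^+ 2)).
Proof.
move=> f0 /(cvg_nested_sumZ (c := 2))/cvgP; apply: is_cvg_psum_le => n.
rewrite -(ltr0n R) => n0; rewrite divr_ge0// mulrCA ler_wpM2l//.
rewrite -[n.+1%:R]natr1 -subr_ge0.
have -> : 2 * (n%:R^-1 - (n%:R + 1)^-1) - n%:R ^- 2
    = (n%:R - 1) / (n%:R ^+ 2 * (n%:R + 1)) :> R.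
  by field; rewrite !gt_eqF// addr_gt0.
by rewrite divr_ge0 ?mulr_ge0 ?exprn_ge0// subr_ge0 ler1n -(ltr0n R).
Qed.

(* By induction on r: summation by parts turns the series of H_n^(r+1) / n^2
   into that of (H_n^(r+1) - H_(n-1)^(r+1)) / n = O(H_n^r / n^2). *)
Lemma is_cvg_psum_gharm1X r :
  cvgn (psum (fun n => gharm 1 n ^+ r / n%:R ^+ 2 : R)).
Proof.
have inv_cvg0 : (fun n => n%:R^-1 : R) @ \oo --> 0.
  by have := @cvg_invr_natD R 0; under eq_fun do rewrite addn0.
elim: r => [|r IH]; apply: is_cvg_psum_div_sqr => [n|];
  rewrite ?exprn_ge0 ?gharm_ge0//.
  apply/cvgP; apply: eq_cvg_nested_sum (cvg_psum_telescope (ltn0Sn 0) inv_cvg0).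
  by move=> n ->; rewrite expr0.
suff : cvgn (psum (fun n =>
    (gharm 1 n ^+ r.+1 - gharm 1 n.-1 ^+ r.+1) / n%:R : R)).
  move=> /cvg_psum_by_parts by_parts; apply/cvgP/by_parts => // [|m n mn|n n0].
  - by rewrite gharm0 expr0n.
  - exact: gharmX_nondecreasing.
  - by rewrite lef_pV2 ?posrE ?ltr0n// ler_nat.
have /cvgP := cvg_nested_sumZ (c := r.+1%:R) IH.
apply: is_cvg_psum_le => -[//|n] _ /=.
rewrite divr_ge0 ?subr_ge0 ?gharmX_nondecreasing//=.
have -> : r.+1%:R * (gharm 1 n.+1 ^+ r / n.+1%:R ^+ 2)
    = r.+1%:R * n.+1%:R^-1 * gharm 1 n.+1 ^+ r / n.+1%:R :> R.
  by rewrite expr2 invfM; ring.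
by rewrite ler_wpM2r ?invr_ge0//; exact: gharmX_subS_le.
Qed.

Lemma is_cvg_psum_dominated r q (u : nat -> R) : (1 < q)%N ->
  (forall n, (0 < n)%N -> 0 <= u n <= gharm 1 n ^+ r / n%:R ^+ q) ->
  cvgn (psum u).
Proof.
move=> q1 u_le; have := @is_cvg_psum_gharm1X r; apply: is_cvg_psum_le => n n0.
have /andP[-> /= /le_trans] := u_le n n0; apply.
rewrite ler_wpM2l ?exprn_ge0 ?gharm_ge0// lef_pV2 ?posrE ?exprn_gt0 ?ltr0n//.
by rewrite ler_weXn2l// ler1n.
Qed.

End HarmonicNumbers.

Section MultipleZetaValues.
Variable R : realType.
Implicit Types s : seq nat.

Definition admissible s := (1 < head 0 s)%N && all (ltn 0) s.

Lemma admissible_rcons s p :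
  admissible s -> (0 < p)%N -> admissible (rcons s p).
Proof.
case: s => // k s /andP[/= k1 /andP[k0 s0]] p0.
by rewrite /admissible/= k1 k0 all_rcons/= p0.
Qed.

Lemma mzv_trunc_ge0 s N : 0 <= mzv_trunc s N :> R.
Proof.
elim: s N => [//|k s IH] N /=; apply: sumr_ge0 => n _.
by rewrite mulr_ge0// invr_ge0 exprn_ge0.
Qed.

Lemma mzv_trunc_le s N : all (ltn 0) s ->
  mzv_trunc s N <= gharm 1 N ^+ size s :> R.
Proof.
elim: s N => [//|k s IH] N /=/andP[k0 s0].
apply: (@le_trans _ _ (gharm k N * gharm 1 N ^+ size s)); last first.
  by rewrite exprS ler_wpM2r ?exprn_ge0 ?gharm_ge0// gharm_le_gharm1.
apply: (@le_trans _ _ (\sum_(1 <= n < N) n%:R ^- k * gharm 1 N ^+ size s)).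
  apply: ler_sum_nat => n /andP[n0 nN].
  rewrite ler_wpM2l ?invr_ge0 ?exprn_ge0//.
  by apply: (le_trans (IH _ s0)); exact/gharmX_nondecreasing/ltnW.
rewrite -mulr_suml ler_wpM2r ?exprn_ge0 ?gharm_ge0//.
by apply: (@nondecreasing_series _ (fun n => n%:R ^- k) predT) => // n _ _;
  rewrite invr_ge0 exprn_ge0.
Qed.

Lemma cvg_mzv s : admissible s -> mzv_trunc s @ \oo --> (mzv s : R).
Proof.
case: s => [//|k s] /andP[/= k1 /andP[_ s0]].
apply: (@is_cvg_psum_dominated _ (size s) _ _ k1) => n _.
rewrite mulr_ge0 ?invr_ge0 ?exprn_ge0 ?mzv_trunc_ge0//=.
by rewrite mulrC ler_wpM2r ?invr_ge0 ?exprn_ge0 ?mzv_trunc_le.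
Qed.

Lemma cvg_nested_sum_invX s p : admissible (rcons s p) ->
  nested_sum s (fun n => n%:R ^- p : R) @ \oo --> mzv (rcons s p).
Proof. by rewrite nested_sum_invX; exact: cvg_mzv. Qed.

End MultipleZetaValues.

Section EulerSums.
Variable R : realType.
Implicit Types s : seq nat.

Definition gharm_prod s n : R := \prod_(k <- s) gharm k n.

Lemma gharm_prod_nil n : gharm_prod [::] n = 1.
Proof. exact: big_nil. Qed.

Lemma gharm_prod_cons k s n :
  gharm_prod (k :: s) n = gharm k n * gharm_prod s n.
Proof. exact: big_cons. Qed.

Lemma gharm_prod_seq1 k n : gharm_prod [:: k] n = gharm k n.
Proof. exact: big_seq1. Qed.

Lemma gharm_prod_ge0 s n : 0 <= gharm_prod s n.
Proof. by apply: prodr_ge0 => k _; exact: gharm_ge0. Qed.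

Lemma gharm_prod_le_gharm1X s n : all (ltn 0) s ->
  gharm_prod s n <= gharm 1 n ^+ size s.
Proof.
elim: s => [|k s IH] /=; first by rewrite gharm_prod_nil.
move=> /andP[k0 s0]; rewrite gharm_prod_cons exprS.
by rewrite ler_pM ?gharm_ge0 ?gharm_prod_ge0 ?gharm_le_gharm1 ?IH.
Qed.

Lemma cvg_euler_sum s q : all (ltn 0) s -> (1 < q)%N ->
  psum (fun n => gharm_prod s n / n%:R ^+ q) @ \oo --> (euler_sum s q : R).
Proof.
move=> s0 q1; apply: (@is_cvg_psum_dominated _ (size s) _ _ q1) => n _.
rewrite divr_ge0 ?gharm_prod_ge0 ?exprn_ge0//=.
by rewrite ler_wpM2r ?invr_ge0 ?exprn_ge0// gharm_prod_le_gharm1X.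
Qed.

Lemma euler_sum_nil q : euler_sum [::] q = mzv [:: q] :> R.
Proof.
congr (limn _); apply/funext => N /=.
by apply: eq_bigr => n _; rewrite big_nil mul1r mulr1.
Qed.

Definition shifted_euler_sum s m j : R :=
  \big[+%R/0]_(1 <= n <oo) (gharm_prod s n / (n%:R ^+ m * (n + j)%:R)).

Definition diff_euler_sum s j : R :=
  \big[+%R/0]_(1 <= n <oo) (gharm_prod s n * (n%:R^-1 - (n + j)%:R^-1)).

Lemma cvg_shifted_euler_sum s m j : all (ltn 0) s -> (0 < m)%N ->
  psum (fun n => gharm_prod s n / (n%:R ^+ m * (n + j)%:R)) @ \oo -->
  shifted_euler_sum s m j.
Proof.
move=> s0 m0; apply: (@is_cvg_psum_dominated _ (size s) m.+1) => // n n0.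
rewrite divr_ge0 ?gharm_prod_ge0 ?mulr_ge0 ?exprn_ge0//=.
rewrite ler_pM ?gharm_prod_ge0 ?gharm_prod_le_gharm1X//.
rewrite lef_pV2 ?posrE ?mulr_gt0 ?exprn_gt0 ?ltr0n ?addn_gt0 ?n0//.
by rewrite exprSr ler_wpM2l ?exprn_ge0// ler_nat leq_addr.
Qed.

Lemma shifted_euler_sum0 s m : shifted_euler_sum s m 0 = euler_sum s m.+1.
Proof.
congr (limn _); apply/funext => N.
by apply: eq_bigr => n _; rewrite addn0 exprSr.
Qed.

Lemma diff_euler_sum_shifted s j : all (ltn 0) s ->
  diff_euler_sum s j = j%:R * shifted_euler_sum s 1 j.
Proof.
move=> s0; apply: lim_psum.
apply: eq_cvg_nested_sum
  (cvg_nested_sumZ (@cvg_shifted_euler_sum s 1 j s0 isT)) => n n0.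
by rewrite natrD; field; rewrite -natrD !pnatr_eq0 -!lt0n addn_gt0 n0.
Qed.

Lemma shifted_euler_sumS s m j : all (ltn 0) s -> (0 < m)%N -> (0 < j)%N ->
  shifted_euler_sum s m.+1 j =
  j%:R^-1 * (euler_sum s m.+1 - shifted_euler_sum s m j).
Proof.
move=> s0 m0 j0; apply: lim_psum.
apply: eq_cvg_nested_sum (cvg_nested_sumZ (cvg_nested_sumB
  (@cvg_euler_sum s m.+1 s0 m0) (cvg_shifted_euler_sum s0 m0))) => n n0.
rewrite natrD exprS; field.
by rewrite -natrD expf_neq0 !pnatr_eq0 -!lt0n ?addn_gt0 n0 ?j0.
Qed.

Lemma shifted_euler_sum_partial_fractions s m j :
  all (ltn 0) s -> (0 < m)%N -> (0 < j)%N ->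
  shifted_euler_sum s m j =
    \sum_(1 <= i < m) (-1) ^+ (i - 1) * euler_sum s (m + 1 - i) * j%:R ^- i
    + (-1) ^+ (m - 1) * (j%:R ^- m * diff_euler_sum s j).
Proof.
move=> s0 m0 j0.
rewrite (@alternating_recurrence_sum R (fun i => shifted_euler_sum s i j)
  (euler_sum s) j%:R^-1)// => [|i i0]; last exact: shifted_euler_sumS.
congr (_ + _); first by apply: eq_bigr => i _; rewrite exprVn.
rewrite diff_euler_sum_shifted// -mulrA; congr (_ * _).
rewrite mulrA; congr (_ * _).
case: m m0 => // m _; rewrite subn1 exprVn exprSr invfM mulfVK//.
by rewrite pnatr_eq0 -lt0n.
Qed.

Lemma diff_euler_sum_nil j : diff_euler_sum [::] j = gharm 1 j.
Proof.
apply: lim_psum; rewrite /gharm big_add1.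
apply: eq_cvg_nested_sum (@cvg_psum_by_parts_natD R (fun n => (0 < n)%:R)
  (fun i => i.+1%:R ^- 1) j erefl _ _) => [n ->|m n|i ij].
- by rewrite gharm_prod_nil.
- by rewrite ler_nat; case: m n => [|m] [|n].
apply: cvg_near_cst; exists 2%N => // N /= N2.
rewrite big_ltn//= subr0 mul1r add1n expr1 big_nat big1 ?addr0//.
by move=> [|[|n]]//= _; rewrite subrr mul0r.
Qed.

Lemma diff_euler_sum_seq1 p j : (0 < p)%N ->
  diff_euler_sum [:: p] j = \sum_(0 <= i < j) shifted_euler_sum [::] p i.
Proof.
move=> p0; apply: lim_psum.
apply: (@cvg_psum_by_parts_natD _ (gharm_prod [:: p])) => [|m n mn|i _].
- by rewrite gharm_prod_seq1 gharm0.
- by rewrite !gharm_prod_seq1 gharm_nondecreasing.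
apply: eq_cvg_nested_sum (@cvg_shifted_euler_sum [::] p i isT p0) => -[//|n] _.
rewrite !gharm_prod_seq1 gharm_prod_nil gharmS [X in _ = X / _]addrAC subrr.
by rewrite add0r mul1r invfM.
Qed.

Lemma diff_euler_sum_pair p q j : (0 < p)%N -> (0 < q)%N ->
  diff_euler_sum [:: p; q] j =
  \sum_(0 <= i < j) (shifted_euler_sum [:: p] q i + shifted_euler_sum [:: q] p i
    - shifted_euler_sum [::] (p + q) i).
Proof.
move=> p0 q0; have pq0 : (0 < p + q)%N by rewrite addn_gt0 p0.
have gharm_pq n : gharm_prod [:: p; q] n = gharm p n * gharm q n.
  by rewrite gharm_prod_cons gharm_prod_seq1.
apply: lim_psum.
apply: (@cvg_psum_by_parts_natD _ (gharm_prod [:: p; q])) => [|m n mn|i _].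
- by rewrite gharm_pq gharm0 mul0r.
- by rewrite !gharm_pq ler_pM ?gharm_ge0 ?gharm_nondecreasing.
apply: eq_cvg_nested_sum (cvg_nested_sumB (cvg_nested_sumD
    (@cvg_shifted_euler_sum [:: p] q i _ q0)
    (@cvg_shifted_euler_sum [:: q] p i _ p0))
  (@cvg_shifted_euler_sum [::] (p + q) i isT pq0)) => [[//|n] _||] /=;
  rewrite ?p0 ?q0//.
rewrite !gharm_pq !gharm_prod_seq1 gharm_prod_nil !gharmS exprD !invfM; ring.
Qed.

Lemma cvg_psum_gharm_prod_shifted s m : all (ltn 0) s ->
  psum (fun n => gharm_prod s n / n%:R * shifted_euler_sum [::] m.+1 n) @ \oo
  -->
    \sum_(1 <= i < m.+1)
      (-1) ^+ (i - 1) * mzv [:: (m.+2 - i)%N] * euler_sum s (i + 1)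
    + (-1) ^+ m * euler_sum (1%N :: s) m.+2.
Proof.
move=> s0; have cvg_terms i : i \in index_iota 1 m.+1 ->
    psum (fun n => (-1) ^+ (i - 1) * mzv [:: (m.+2 - i)%N]
                   * (gharm_prod s n / n%:R ^+ (i + 1))) @ \oo -->
    (-1) ^+ (i - 1) * mzv [:: (m.+2 - i)%N] * (euler_sum s (i + 1) : R).
  rewrite mem_index_iota => /andP[i0 _]; apply: cvg_nested_sumZ.
  by apply: cvg_euler_sum => //; rewrite addn1.
apply: eq_cvg_nested_sum (cvg_nested_sumD (cvg_nested_sum_sum cvg_terms)
  (cvg_nested_sumZ (@cvg_euler_sum (1%N :: s) m.+2 s0 isT))) => n n0.
rewrite shifted_euler_sum_partial_fractions// diff_euler_sum_nil.
rewrite mulrDr mulr_sumr; congr (_ + _).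
  by apply: eq_bigr => i _; rewrite euler_sum_nil !addn1 exprS invfM; ring.
by rewrite subn1 gharm_prod_cons exprS invfM; ring.
Qed.

(* Both this series and the previous one sum
   gharm_prod s n / (n k^m.+1 (k + n)) over all n, k >= 1. *)
Lemma cvg_psum_diff_euler_sum s m : all (ltn 0) s ->
  psum (fun k => k%:R ^- m.+2 * diff_euler_sum s k) @ \oo -->
    \sum_(1 <= i < m.+1)
      (-1) ^+ (i - 1) * mzv [:: (m.+2 - i)%N] * euler_sum s (i + 1)
    + (-1) ^+ m * euler_sum (1%N :: s) m.+2.
Proof.
move=> s0; apply: (cvg_psum_exchange
  (a := fun n k => gharm_prod s n / n%:R * (1 / (k%:R ^+ m.+1 * (k + n)%:R)))
  _ _ _ (cvg_psum_gharm_prod_shifted s0)).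
- by move=> n k; rewrite !mulr_ge0 ?gharm_prod_ge0.
- move=> n n0; apply: cvg_nested_sumZ.
  apply: eq_cvg_nested_sum (@cvg_shifted_euler_sum [::] m.+1 n isT isT) => k _.
  by rewrite gharm_prod_nil.
move=> k k0; have k_neq0 : k%:R != 0 :> R by rewrite pnatr_eq0 -lt0n.
rewrite diff_euler_sum_shifted// mulrA [_ ^+ m.+2]exprSr invfM mulfVK//.
apply: eq_cvg_nested_sum
  (cvg_nested_sumZ (@cvg_shifted_euler_sum s 1 k s0 isT)) => n _.
by rewrite [(k + n)%N]addnC div1r !invfM; ring.
Qed.

End EulerSums.

Arguments gharm_prod {R} s n.
Arguments shifted_euler_sum {R} s m j.
Arguments diff_euler_sum {R} s j.

Section NestedEvaluation.
Variable R : realType.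
Implicit Types (s t : seq nat) (l : R).

Lemma cvg_nested_sum_shifted_euler_sum t s m l :
  admissible t -> all (ltn 0) s -> (0 < m)%N ->
  nested_sum t (fun j => j%:R ^- m * diff_euler_sum s j) @ \oo --> l ->
  nested_sum t (shifted_euler_sum s m) @ \oo -->
    \sum_(1 <= i < m)
      (-1) ^+ (i - 1) * euler_sum s (m + 1 - i) * mzv (rcons t i)
    + (-1) ^+ (m - 1) * l.
Proof.
move=> t_adm s0 m0 cvg_weighted.
have cvg_terms i : i \in index_iota 1 m -> nested_sum t (fun j =>
    (-1) ^+ (i - 1) * euler_sum s (m + 1 - i) * j%:R ^- i) @ \oo
    --> (-1) ^+ (i - 1) * euler_sum s (m + 1 - i) * (mzv (rcons t i) : R).
  rewrite mem_index_iota => /andP[i0 _]; apply: cvg_nested_sumZ.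
  exact/cvg_nested_sum_invX/admissible_rcons.
apply: eq_cvg_nested_sum (cvg_nested_sumD (cvg_nested_sum_sum cvg_terms)
  (cvg_nested_sumZ cvg_weighted)) => j j0.
by rewrite shifted_euler_sum_partial_fractions.
Qed.

Lemma cvg_nested_sum_rcons_from0 t p (e : nat -> R) l :
  admissible (rcons t p) -> nested_sum (rcons t p) e @ \oo --> l ->
  nested_sum t (fun k => k%:R ^- p * \sum_(0 <= j < k) e j) @ \oo -->
    e 0 * mzv (rcons t p) + l.
Proof.
move=> tp_adm; rewrite nested_sum_rcons => el.
apply: eq_cvg_nested_sum (cvg_nested_sumD
  (cvg_nested_sumZ (c := e 0) (@cvg_nested_sum_invX R _ _ tp_adm)) el) => k k0.
by rewrite [in RHS]big_ltn// mulrDr [e 0 * _]mulrC.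
Qed.

Lemma cvg_nested_sum_shifted_euler_sum_nil t p : admissible t -> (0 < p)%N ->
  nested_sum t (shifted_euler_sum [::] p : nat -> R) @ \oo -->
    \sum_(1 <= i < p)
      (-1) ^+ (i - 1) * mzv [:: (p + 1 - i)%N] * mzv (rcons t i)
    + (-1) ^+ (p - 1) * (mzv (rcons (rcons t p) 1) + mzv (rcons t (p + 1))).
Proof.
move=> t_adm p0.
under eq_bigr do rewrite -euler_sum_nil.
apply: cvg_nested_sum_shifted_euler_sum => //.
have := @cvg_nested_sum_invX R (rcons t p) 1.
rewrite nested_sum_rcons => cvg_p1.
apply: eq_cvg_nested_sum (cvg_nested_sumD (cvg_p1 _)
  (@cvg_nested_sum_invX R t (p + 1) _)) => [j j0||]; last 2 first.
- by rewrite !admissible_rcons.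
- by rewrite admissible_rcons// addn1.
case: j j0 => // j _; rewrite diff_euler_sum_nil gharmS mulrDr.
by rewrite exprD invfM /gharm.
Qed.

Lemma cvg_nested_sum_shifted_euler_sum_seq1 t p q :
  admissible t -> (0 < p)%N -> (0 < q)%N ->
  nested_sum t (shifted_euler_sum [:: p] q : nat -> R) @ \oo -->
    \sum_(1 <= i < q)
      (-1) ^+ (i - 1) * euler_sum [:: p] (q + 1 - i) * mzv (rcons t i)
    + (-1) ^+ (q - 1) * (mzv [:: (p + 1)%N] * mzv (rcons t q)
      + (\sum_(1 <= i < p)
           (-1) ^+ (i - 1) * mzv [:: (p + 1 - i)%N] * mzv (rcons (rcons t q) i)
         + (-1) ^+ (p - 1) * (mzv (rcons (rcons (rcons t q) p) 1)
                              + mzv (rcons (rcons t q) (p + 1))))).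
Proof.
move=> t_adm p0 q0; apply: cvg_nested_sum_shifted_euler_sum => //=.
  by rewrite p0.
have tq_adm := admissible_rcons t_adm q0.
have <- : shifted_euler_sum [::] p 0 = mzv [:: (p + 1)%N] :> R.
  by rewrite shifted_euler_sum0 euler_sum_nil addn1.
under eq_nested_sum do rewrite diff_euler_sum_seq1//.
apply: cvg_nested_sum_rcons_from0 => //.
exact: cvg_nested_sum_shifted_euler_sum_nil.
Qed.

Lemma cvg_nested_sum_diff_euler_sum_pair t p q m l1 l2 l3 :
  admissible (rcons t m) -> (0 < p)%N -> (0 < q)%N ->
  nested_sum (rcons t m) (shifted_euler_sum [:: p] q) @ \oo --> l1 ->
  nested_sum (rcons t m) (shifted_euler_sum [:: q] p) @ \oo --> l2 ->
  nested_sum (rcons t m) (shifted_euler_sum [::] (p + q)) @ \oo --> l3 ->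
  nested_sum t (fun k => k%:R ^- m * diff_euler_sum [:: p; q] k) @ \oo -->
    (euler_sum [:: p] (q + 1) + euler_sum [:: q] (p + 1)
     - mzv [:: (p + q + 1)%N]) * mzv (rcons t m) + (l1 + l2 - l3).
Proof.
move=> tm_adm p0 q0 cvg_pq cvg_qp cvg_zeta.
under eq_nested_sum do rewrite diff_euler_sum_pair//.
rewrite !addn1 -euler_sum_nil -!shifted_euler_sum0.
have := cvg_nested_sumB (cvg_nested_sumD cvg_pq cvg_qp) cvg_zeta.
exact: (cvg_nested_sum_rcons_from0 tm_adm).
Qed.

End NestedEvaluation.

Theorem theorem2p3 (R : realType) (m1 m2 m3 : nat)
    (hm1 : (1 <= m1)%N) (hm2 : (1 <= m2)%N) (hm3 : (2 <= m3)%N) :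
  (euler_sum [:: 1; m1; m2]%N m3 : R) =
    (-1) ^+ (m3 - 1) *
      (\sum_(1 <= i < (m3 - 2).+1)
         (-1) ^+ (i - 1) * mzv [:: m3 - i]%N * euler_sum [:: m1; m2] (i + 1))
  + (-1) ^+ m3 *
      (euler_sum [:: m1] (m2 + 1) + euler_sum [:: m2] (m1 + 1)
       - mzv [:: m1 + m2 + 1]%N) * mzv [:: m3]
  + (-1) ^+ m3 *
      ((\sum_(1 <= i < (m2 - 1).+1)
          (-1) ^+ (i - 1) * euler_sum [:: m1] (m2 + 1 - i) * mzv [:: m3; i])
       + (\sum_(1 <= i < (m1 - 1).+1)
          (-1) ^+ (i - 1) * euler_sum [:: m2] (m1 + 1 - i) * mzv [:: m3; i]))
  + (-1) ^+ m3 *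
      ((-1) ^+ (m2 - 1) * mzv [:: m1 + 1]%N * mzv [:: m3; m2]
       + (-1) ^+ (m1 - 1) * mzv [:: m2 + 1]%N * mzv [:: m3; m1])
  + (-1) ^+ m3 *
      ((-1) ^+ (m2 - 1) *
         (\sum_(1 <= i < (m1 - 1).+1)
            (-1) ^+ (i - 1) * mzv [:: m1 + 1 - i]%N * mzv [:: m3; m2; i])
       + (-1) ^+ (m1 - 1) *
         (\sum_(1 <= i < (m2 - 1).+1)
            (-1) ^+ (i - 1) * mzv [:: m2 + 1 - i]%N * mzv [:: m3; m1; i]))
  + (-1) ^+ (m1 + m2 + m3) *
      (mzv [:: m3; m2; m1; 1]%N + mzv [:: m3; m1; m2; 1]%N
       + mzv [:: m3; m2; m1 + 1]%N + mzv [:: m3; m1; m2 + 1]%N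
       + mzv [:: m3; m1 + m2; 1]%N + mzv [:: m3; m1 + m2 + 1]%N)
  - (-1) ^+ m3 *
      (\sum_(1 <= i < (m1 + m2 - 1).+1)
         (-1) ^+ (i - 1) * mzv [:: m1 + m2 + 1 - i]%N * mzv [:: m3; i]).
Proof.
case: m3 hm3 => [|[|m]]// _.
have m3_adm : admissible [:: m.+2] by [].
have m12_gt0 : (0 < m1 + m2)%N by rewrite addn_gt0 hm1.
have m12_all : all (ltn 0) [:: m1; m2] by rewrite /= hm1 hm2.
have sum_k_first := @cvg_psum_diff_euler_sum R _ m m12_all.
have sum_n_first := @cvg_nested_sum_diff_euler_sum_pair R [::] _ _ _ _ _ _
  m3_adm hm1 hm2 (cvg_nested_sum_shifted_euler_sum_seq1 m3_adm hm1 hm2)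
  (cvg_nested_sum_shifted_euler_sum_seq1 m3_adm hm2 hm1)
  (cvg_nested_sum_shifted_euler_sum_nil m3_adm m12_gt0).
have := lim_psum sum_n_first; rewrite (lim_psum sum_k_first).
have signB1 n : (0 < n)%N -> (-1) ^+ (n - 1) = - (-1) ^+ n :> R.
  by case: n => // n _; rewrite subn1 exprS mulN1r opprK.
rewrite /= !subnSK// !subn0 !signB1// !exprD !exprS.
have := sqrr_sign R m.
move: ((-1) ^+ m1) ((-1) ^+ m2) ((-1) ^+ m) => sgn1 sgn2 sgn3 sgn3_sqr.
set zeta_terms := \sum_(1 <= i < m.+1) _.
move=> /(congr1 (fun x => sgn3 * (x - zeta_terms))).
rewrite addrAC subrr add0r mulrA -expr2 sgn3_sqr mul1r => ->.
ring.
Qed.
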